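(* For every positive integer $k$, there exists a cyclically $k$-edge-connected cubic graph without a Hist.
   Context: All graphs are finite and simple. A cubic graph is a $3$-regular graph. A Hist (homeomorphically irreducible spanning tree) of a connected graph $G$ is a spanning tree of $G$ which has no vertex of degree two (degree taken in the tree). For an integer $k$, a connected cubic graph $G$ which contains two (vertex-)disjoint cycles is said to be cyclically $k$-edge-connected if deleting any set of at most $k-1$ edges from $G$ does not separate $G$ into two components both of which have a cycle. *)

(* Defs.v *)
From mathcomp Require Import all_boot.

Set Implicit Arguments.
Unset Strict Implicit.
Unset Printing Implicit Defensive.

Record sgraph := SGraph {
  vertex :> finType;
  adj : rel vertex;
  adj_sym : symmetric adj;
  adj_irrefl : irreflexive adj
}.

(* The notions below take a bare adjacency relation, so that they apply both
   to a graph and to its spanning subgraphs (a spanning tree, or the graph left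
   after deleting edges), which live on the same vertex type. *)
Section Notions.
Variable T : finType.
Implicit Types (e t : rel T) (c : seq T) (F : {set {set T}}).

Definition degree e (x : T) : nat := #|[set y | e x y]|.

Definition cubic e : Prop := forall x : T, degree e x = 3.

Definition connected_graph e : Prop :=
  0 < #|T| /\ forall x y : T, connect e x y.

(* [cycle e [:: x]] and [cycle e [:: x; y]] hold for a loop and for an edge
   traversed back and forth, hence the bound on the size. *)
Definition is_cycle e c : bool := [&& 2 < size c, uniq c & cycle e c].

Definition two_disjoint_cycles e : Prop :=
  exists c1 c2 : seq T,
    [/\ is_cycle e c1, is_cycle e c2 & [disjoint c1 & c2]].

Definition edges e : {set {set T}} :=
  [set [set p.1; p.2] | p : T * T & e p.1 p.2].

Definition delete_edges e F : rel T :=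
  [rel x y | e x y && ([set x; y] \notin F)].

Definition component e (x : T) : {set T} := [set y | connect e x y].

Definition has_cycle_in e (A : {set T}) : Prop :=
  exists2 c : seq T, is_cycle e c & {subset c <= A}.

(* Two distinct components with a cycle are required, but not that there be no
   further component: when e is connected, putting deleted edges back one by
   one reduces the latter case to exactly two components, each with a cycle. *)
Definition cyclically_separates e F : Prop :=
  let e' := delete_edges e F in
  exists x y : T,
    [/\ component e' x <> component e' y,
        has_cycle_in e' (component e' x) &
        has_cycle_in e' (component e' y)].

Definition cyclically_edge_connected (k : nat) e : Prop :=
  [/\ connected_graph e,
      two_disjoint_cycles e &
      forall F, F \subset edges e -> #|F| <= k - 1 ->
        ~ cyclically_separates e F].

Definition is_tree t : Prop :=
  connected_graph t /\ forall c, ~~ is_cycle t c.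

Definition spanning_tree e t : Prop :=
  [/\ symmetric t, subrel t e & is_tree t].

Definition is_hist e t : Prop :=
  spanning_tree e t /\ forall x : T, degree t x <> 2.

Definition has_hist e : Prop := exists t : rel T, is_hist e t.

End Notions.

(* Main.v *)
Require Import Defs.
From mathcomp Require Import all_boot all_fingroup zify.

Set Implicit Arguments.
Unset Strict Implicit.
Unset Printing Implicit Defensive.

(* All degrees of a Hist of a cubic graph are odd. If the graph is bipartite,
   the degrees over one colour class add up to the number [#|V| - 1] of edges of
   the tree, so there is no Hist when [#|V|] and the size of a colour class are
   both even.

   The examples are Cayley graphs of groups generated by three involutions that
   satisfy no relation of length at most [2k]. Vertex transitivity and large
   girth force high cyclic connectivity. The involutions act on the reduced words
   of length at most [2k] as in the free product of three groups of order 2; two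
   additional signs, one changed by every generator and the other by the last
   generator only, make the graph bipartite with colour classes of even size. *)

(** * Counting the edges of a finite tree *)

Section Trees.
Variables (T : finType) (t : rel T).
Hypotheses (t_sym : symmetric t) (t_irr : irreflexive t).
Implicit Types X : {set T}.

Definition induced_rel X : rel T := [rel x y | [&& x \in X, y \in X & t x y]].

Definition induced_darts X : {set T * T} :=
  [set d | [&& d.1 \in X, d.2 \in X & t d.1 d.2]].

Definition induced_connected X : Prop :=
  {in X &, forall u v, connect (induced_rel X) u v}.

Lemma connect_leaves_set X x z :
  connect t x z -> x \in X -> z \notin X ->
  exists u v, [/\ u \in X, v \notin X & t u v].
Proof.
case/connectP=> s; elim: s x => [|y s IHs] x /=.
  by move=> _ -> ->.
case/andP=> txy ys zE xX zX; case: (boolP (y \in X)) => yX.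
  exact: IHs ys zE yX zX.
by exists x, y.
Qed.

(** A simple path inside [X] between two distinct neighbours of [y] would close up to a cycle
    through [y]. *)
Lemma acyclic_unique_neighbour X y u v :
  (forall c, ~~ is_cycle t c) -> induced_connected X ->
  y \notin X -> u \in X -> v \in X -> t u y -> t v y -> u = v.
Proof.
move=> acyc connX yX uX vX tuy tvy; apply/eqP/negPn/negP => uv.
case/connectP: (connX u v uX vX) => s sP vE.
case/shortenP: sP vE => s' s'P s'U _ vE.
have sX : {subset u :: s' <= X}.
  move: {vE s'U} u uX s'P {tuy uv} => u; elim: s' u => [|z s' IHs] u uX /=.
    by move=> _ w; rewrite inE => /eqP->.
  case/andP=> /and3P[_ zX _] zs w; rewrite inE => /predU1P[-> //|].
  exact: IHs.
apply/negP: (acyc (y :: u :: s')); rewrite negbK /is_cycle.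
apply/and3P; split.
- by case: s' vE uv {s'P s'U sX} => //= ->; rewrite eqxx.
- by rewrite cons_uniq s'U andbT; apply: contra yX => /sX.
rewrite /= t_sym tuy rcons_path -vE tvy andbT.
by apply: sub_path s'P => a b /and3P[].
Qed.

Lemma connect_induced_sub (X Y : {set T}) : X \subset Y ->
  subrel (connect (induced_rel X)) (connect (induced_rel Y)).
Proof.
move/subsetP=> XY; apply: connect_sub => a b /and3P[aX bX tab].
by apply: connect1; apply/and3P; split; rewrite ?XY.
Qed.

(** Grow a connected set from a single root. Each added vertex [y] has exactly one neighbour [u] in
    the set so far, so it contributes the two darts of the edge [uy]. *)
Lemma tree_dart_count : is_tree t -> \sum_x degree t x + 2 = 2 * #|T|.
Proof.
move=> [[T0 conn] acyc].
have grow n : n < #|T| ->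
    exists X, [/\ #|X| = n.+1, induced_connected X
                & #|induced_darts X| + 2 = 2 * #|X|].
  elim: n => [|n IHn] ltn.
    case/card_gt0P: T0 => r _; exists [set r]; rewrite cards1; split=> //.
      by move=> u v /set1P-> /set1P->.
    rewrite (_ : induced_darts _ = set0) ?cards0 //.
    apply/setP=> -[a b]; rewrite !inE /=; apply/negP=> /and3P[/eqP-> /eqP->].
    by rewrite t_irr.
  have [X [cX connX dX]] := IHn (ltnW ltn).
  have [x xX] : exists x, x \in X by apply/card_gt0P; rewrite cX.
  have [z zX] : exists z, z \notin X.
    have /card_gt0P[z] : 0 < #|~: X| by rewrite cardsCs setCK cX subn_gt0.
    by rewrite inE; exists z.
  have [u [y [uX yX tuy]]] := connect_leaves_set (conn x z) xX zX.
  have uniq_u v : v \in X -> t v y -> v = u.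
    by move=> vX tvy; apply: (acyclic_unique_neighbour acyc connX yX).
  exists (y |: X); rewrite cardsU1 yX cX; split=> //.
  - have XY : X \subset y |: X by apply: subsetUr.
    have c1 : connect (induced_rel (y |: X)) u y.
      by apply: connect1; rewrite /induced_rel /= !inE eqxx uX orbT.
    have c2 : connect (induced_rel (y |: X)) y u.
      by apply: connect1; rewrite /induced_rel /= !inE eqxx uX orbT t_sym.
    move=> a b; rewrite !inE => /predU1P[-> | aX] /predU1P[-> | bX].
    + exact: connect0.
    + by apply: connect_trans c2 (connect_induced_sub XY (connX _ _ uX bX)).
    + by apply: connect_trans (connect_induced_sub XY (connX _ _ aX uX)) c1.
    + exact: connect_induced_sub XY _ _ (connX _ _ aX bX).
  have yu : (y == u) = false by apply: contraNF yX => /eqP->.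
  rewrite (_ : induced_darts _ = (u, y) |: ((y, u) |: induced_darts X)).
    rewrite !cardsU1 !inE /= (negPf yX) !andbF /= xpair_eqE (eq_sym u) yu /=.
    by rewrite mulnDr -cX -dX !addnA.
  apply/setP=> -[a b]; rewrite !inE /= !xpair_eqE.
  have [->|ay] := eqVneq a y; have [->|by_] := eqVneq b y;
    rewrite /= ?(negPf yX) ?andbF ?andbT ?orbF ?t_irr //=.
  - by rewrite yu.
  - apply/andP/eqP=> [[bX tyb]|->]; last by rewrite uX t_sym.
    by apply: uniq_u => //; rewrite t_sym.
  - by apply/andP/eqP=> [[aX tay]|->]; [exact: uniq_u | rewrite uX].
have [X [cX _]] := grow #|T|.-1 (eq_leq (prednK T0)).
rewrite prednK // in cX.
have -> : X = setT by apply/eqP; rewrite eqEcard subsetT cardsT cX leqnn.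
rewrite cardsT => <-; congr (_ + 2).
rewrite -sum1_card (eq_bigl (fun d => true && t d.1 d.2)); last first.
  by move=> d; rewrite !inE.
rewrite -(pair_big_dep xpredT t (fun _ _ => 1)) /=.
by apply: eq_bigr => x _; rewrite sum1_card /degree cardsE.
Qed.

End Trees.

(** * The parity obstruction in bipartite cubic graphs *)

Lemma bipartite_no_hist (T : finType) (e : rel T) (p : pred T) :
  irreflexive e -> cubic e -> (forall x y, e x y -> p y = ~~ p x) ->
  ~~ odd #|T| -> ~~ odd #|p| -> ~ has_hist e.
Proof.
move=> e_irr e3 e_p Teven peven [t [[t_sym te tree] t2]].
have t_irr : irreflexive t.
  by move=> x; apply/negP=> /te; rewrite e_irr.
have sum_deg := tree_dart_count t_sym t_irr tree.
have [[T0 conn] _] := tree.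
(* Every tree edge has one end in each class, so both sums count the tree edges. *)
have classes : \sum_(x | p x) degree t x = \sum_(x | ~~ p x) degree t x.
  transitivity (\sum_(x | p x) \sum_(y | ~~ p y && t x y) 1).
    apply: eq_bigr => x px; rewrite sum1_card /degree cardsE.
    apply: eq_card => y; rewrite /in_mem /=; apply/idP/andP=> [txy|[]//].
    by rewrite (e_p x y (te _ _ txy)) px.
  rewrite (exchange_big_dep (fun y => ~~ p y)) /=; last by move=> x y _ /andP[].
  apply: eq_bigr => y py; rewrite sum1_card /degree cardsE.
  apply: eq_card => x; rewrite /in_mem /= py /= t_sym.
  apply/andP/idP=> [[]//|tyx]; split=> //.
  by rewrite (e_p y x (te _ _ tyx)) py.
have deg_odd x : odd (degree t x).
  have le3 : degree t x <= 3.
    rewrite -(e3 x); apply/subset_leq_card/subsetP=> y; rewrite !inE; exact: te.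
  have T1 : 1 < #|T| by case: #|T| T0 Teven => [|[]].
  have gt0 : 0 < degree t x.
    have /card_gt0P[z] : 0 < #|[set~ x]|.
      by rewrite cardsC1 -subn1 subn_gt0.
    rewrite !inE => zx.
    have [u [v [/set1P-> _ txv]]] :=
      connect_leaves_set (conn x z) (set11 x) (introN set1P (elimN eqP zx)).
    by apply/card_gt0P; exists v; rewrite inE.
  by have := t2 x; case: (degree t x) le3 gt0 => [|[|[|[|]]]].
have edge_count : \sum_(x | p x) degree t x + 1 = #|T|.
  apply/eqP; rewrite -(eqn_pmul2l (isT : 0 < 2)) -sum_deg mulnDr muln1 eqn_add2r.
  rewrite mul2n -addnn {2}classes; apply/eqP.
  exact/esym/bigID.
have : odd (\sum_(x | p x) degree t x) = odd #|p|.
  rewrite -sum1_card; apply: (big_ind2 (fun a b => odd a = odd b)) => //.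
    by move=> a b c d; rewrite !oddD => -> ->.
  by move=> x _; rewrite deg_odd.
rewrite (negPf peven); move: Teven; rewrite -edge_count addn1 /= negbK => ->.
by [].
Qed.

(** * Cubic Cayley graphs of groups generated by three involutions *)

Definition reduced (w : seq 'I_3) : bool := sorted (fun i j => i != j) w.

Section InvolutionCayleyGraph.
Local Open Scope group_scope.
Variables (gT : finGroupType) (gen : 'I_3 -> gT) (m : nat).

Definition word_prod (w : seq 'I_3) : gT := \prod_(i <- w) gen i.

Definition cayley_adj : rel gT := fun x y => [exists i, y == x * gen i].

Hypothesis gen_invol : forall i, gen i * gen i = 1.
Hypothesis gen_words : forall x, exists w, x = word_prod w.
Hypothesis word_prod_neq1 : forall w,
  0 < size w <= m -> reduced w -> word_prod w != 1.
Hypothesis m_gt1 : 1 < m.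

Implicit Types (x y : gT) (i j : 'I_3) (w : seq 'I_3) (X Y : {set gT}).

Lemma word_prod_cons i w : word_prod (i :: w) = gen i * word_prod w.
Proof. exact: big_cons. Qed.

Lemma word_prod_cat w1 w2 : word_prod (w1 ++ w2) = word_prod w1 * word_prod w2.
Proof. exact: big_cat. Qed.

Lemma mul_genK i : involutive (mulg^~ (gen i)).
Proof. by move=> x; rewrite /= -mulgA gen_invol mulg1. Qed.

Lemma gen_neq1 i : gen i != 1.
Proof.
have := @word_prod_neq1 [:: i]; rewrite /word_prod big_seq1; apply=> //=.
by rewrite ltnW.
Qed.

Lemma mul_gen_neq x i : x * gen i != x.
Proof.
apply/eqP=> /(canRL (mulKg x)); rewrite mulVg => /eqP.
by apply/negP/gen_neq1.
Qed.

Lemma gen_inj : injective gen.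
Proof.
move=> i j ij; apply/eqP/negPn/negP=> nij.
have /negP[] : word_prod [:: i; j] != 1.
  by apply: word_prod_neq1; rewrite //= nij.
by rewrite /word_prod !big_cons big_nil mulg1 ij gen_invol.
Qed.

Lemma cayley_adjP x y : reflect (exists i, y = x * gen i) (cayley_adj x y).
Proof. exact: 'exists_eqP. Qed.

Lemma cayley_adj_gen x i : cayley_adj x (x * gen i).
Proof. by apply/cayley_adjP; exists i. Qed.

Lemma cayley_sym : symmetric cayley_adj.
Proof.
by move=> x y; apply/cayley_adjP/cayley_adjP=> -[i ->]; exists i;
  rewrite -mulgA gen_invol mulg1.
Qed.

Lemma cayley_irrefl : irreflexive cayley_adj.
Proof.
by move=> x; apply/negbTE/cayley_adjP=> -[i /esym/eqP]; apply/negP/mul_gen_neq.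
Qed.

Lemma cayley_cubic : cubic cayley_adj.
Proof.
move=> x; rewrite /degree (_ : [set y | _] = [set x * gen i | i : 'I_3]).
  by rewrite card_imset ?card_ord // => i j /mulgI/gen_inj.
apply/setP=> y; rewrite inE; apply/cayley_adjP/imsetP=> [[i ->]|[i _ ->]].
  by exists i.
by exists i.
Qed.

Lemma gen_closed_setT X x :
  x \in X -> (forall y i, y \in X -> y * gen i \in X) -> X = setT.
Proof.
move=> xX clX; apply/setP=> z; rewrite inE.
have [w wE] := gen_words (x^-1 * z).
have -> : z = x * word_prod w by rewrite -wE mulKVg.
elim: w x xX {wE} => [|i w IHw] x xX; first by rewrite /word_prod big_nil mulg1.
by rewrite word_prod_cons mulgA IHw ?clX.
Qed.

Lemma cayley_connected : connected_graph cayley_adj.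
Proof.
split=> [|x y]; first by apply/card_gt0P; exists 1.
have : [set z | connect cayley_adj x z] = setT.
  apply: (@gen_closed_setT _ x) => [|z i]; rewrite !inE // => xz.
  by apply: connect_trans xz (connect1 (cayley_adj_gen z i)).
by move/setP/(_ y); rewrite !inE.
Qed.

(** * Edge boundaries of vertex sets *)

Definition out_darts X : {set gT * 'I_3} :=
  [set d | (d.1 \in X) && (d.1 * gen d.2 \notin X)].

(** An edge inside [X] appears here twice, once from each end, while a boundary edge appears once in
    [out_darts X]. *)
Definition inner_darts X : {set gT * 'I_3} :=
  [set d | (d.1 \in X) && (d.1 * gen d.2 \in X)].

Lemma card_out_darts_setC X : #|out_darts (~: X)| = #|out_darts X|.
Proof.
pose rv (d : gT * 'I_3) := (d.1 * gen d.2, d.2).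
have rvK : involutive rv by case=> x i; rewrite /rv /= mul_genK.
rewrite -(card_imset _ (inv_inj rvK)); apply: eq_card => d.
rewrite -[in LHS](rvK d) (mem_imset _ _ (inv_inj rvK)) !inE negbK /=.
by rewrite mul_genK andbC.
Qed.

(** The inequality already holds for the contribution of each single dart, by cases on where its two
    ends lie. *)
Lemma card_out_darts_submodular X Y :
  #|out_darts (X :&: Y)| + #|out_darts (X :|: Y)|
    <= #|out_darts X| + #|out_darts Y|.
Proof.
rewrite -!sum1_card ![\sum_(d in _) _]big_mkcond -!big_split /=.
apply: leq_sum => -[x i] _; rewrite !inE /=.
by do 2![case: (x \in _)]; do 2![case: (_ * _ \in _)].
Qed.

(** Left translations commute with right multiplication by generators, so they are automorphisms of
    the graph. *)
Lemma card_out_darts_lcoset h X : #|out_darts (h *: X)| = #|out_darts X|.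
Proof.
pose f (d : gT * 'I_3) := (h * d.1, d.2).
have f_inj : injective f by case=> x i [y j] [/mulgI-> ->].
rewrite -(card_imset (out_darts X) f_inj); apply: eq_card => -[x i].
have -> : (x, i) = f (h^-1 * x, i) by rewrite /f /= mulKVg.
by rewrite (mem_imset _ _ f_inj) !inE /= !mem_lcoset !mulgA mulVg !mul1g.
Qed.

Lemma card_darts X : #|inner_darts X| + #|out_darts X| = (3 * #|X|)%N.
Proof.
transitivity #|setX X [set: 'I_3]|; last first.
  by rewrite cardsX cardsT card_ord mulnC.
rewrite -(cardsID (inner_darts X) (setX _ _)); congr (_ + _); apply: eq_card.
  by case=> x i; rewrite !inE /=; case: (x \in X).
by case=> x i; rewrite !inE /=; case: (x \in X); rewrite ?andbT ?andbF.
Qed.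

(* A set of at most [m] vertices in which every vertex keeps two neighbours
   would contain a non-backtracking walk that revisits a vertex. *)
Lemma small_set_has_leaf X : 0 < #|X| <= m ->
  exists2 x, x \in X & #|[set i | x * gen i \in X]| <= 1.
Proof.
move=> /andP[X0 Xm].
case: (boolP [exists x in X, #|[set i | x * gen i \in X]| <= 1]).
  by move/exists_inP.
rewrite negb_exists_in => /forall_inP two; exfalso.
have step x i : x \in X -> exists2 j, i != j & x * gen j \in X.
  move=> xX; have := two x xX; rewrite -ltnNge (cardsD1 i) => lt1.
  have /card_gt0P[j] : 0 < #|[set j | x * gen j \in X] :\ i|.
    by move: lt1; case: (i \in _) => /=; case: #|_|.
  by rewrite !inE eq_sym => /andP[]; exists j.
have walk n : forall x i, x \in X -> exists w, [/\ size w = n,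
    path (fun i j => i != j) i w &
    forall l, x * word_prod (take l w) \in X].
  elim: n => [|n IHn] x i xX.
    by exists [::]; split=> // l; rewrite /word_prod big_nil mulg1.
  have [j ij xj] := step x i xX; have [w [sw pw wX]] := IHn _ j xj.
  exists (j :: w); split; rewrite /= ?sw ?ij //.
  case=> [|l]; first by rewrite /word_prod big_nil mulg1.
  by rewrite /= word_prod_cons mulgA.
have [x xX] := card_gt0P X0; have [w [sw pw wX]] := walk #|X| x ord0 xX.
have redw : reduced w by apply: path_sorted pw.
pose f (l : 'I_#|X|.+1) := x * word_prod (take l w).
(* The walk of length [#|X|] has one more position than [X] has elements, so two positions coincide.
   The word read between them is reduced, nonempty, of length at most [m], and has product 1. *)
have /injectivePn[l1 [l2 l12 fl]] : ~~ injectiveb f.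
  apply/negP=> /injectiveP f_inj.
  have : #|f @: 'I_#|X|.+1| <= #|X|.
    by apply/subset_leq_card/subsetP=> _ /imsetP[l _ ->]; apply: wX.
  by rewrite card_imset // card_ord ltnn.
wlog lt12 : l1 l2 l12 fl / l1 < l2.
  move=> wl; case: (ltngtP l1 l2) => [||/val_inj e]; first exact: wl.
    by apply: wl => //; rewrite eq_sym.
  by rewrite e eqxx in l12.
have le2 : l2 <= size w by rewrite sw -ltnS ltn_ord.
have /negP[] : word_prod (drop l1 (take l2 w)) != 1.
  apply: word_prod_neq1; last by apply: drop_sorted; apply: take_sorted.
  rewrite size_drop size_takel // subn_gt0 lt12 /=.
  by rewrite (leq_trans (leq_subr _ _)) // (leq_trans le2) // sw.
apply/eqP/(mulgI (word_prod (take l1 w))); rewrite mulg1.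
have fl' : word_prod (take l2 w) = word_prod (take l1 w).
  exact/esym/(mulgI x).
by rewrite -{2}fl' -[in RHS](cat_take_drop l1 (take l2 w)) word_prod_cat
  take_takel 1?ltnW.
Qed.

(** Induction by removing a vertex with at most one neighbour in the set: this destroys at most one
    inner edge, that is two darts. *)
Lemma card_inner_darts_small X : #|X| <= m -> #|inner_darts X| <= (2 * #|X|)%N.
Proof.
move cX: #|X| => n; elim: n X cX => [|n IHn] X cX nm.
  move/eqP: cX; rewrite cards_eq0 => /eqP->; rewrite leqn0 cards_eq0.
  by apply/eqP/setP=> d; rewrite !inE.
have [|x xX leaf] := @small_set_has_leaf X; first by rewrite cX.
have cX' : #|X :\ x| = n by move: cX; rewrite (cardsD1 x) xX => -[].
have {}IHn := IHn _ cX' (ltnW nm).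
pose L := [set i | x * gen i \in X].
have sub : inner_darts X \subset inner_darts (X :\ x)
    :|: ((pair x) @: L :|: (fun i => (x * gen i, i)) @: L).
  apply/subsetP=> -[y i]; rewrite !inE /= => /andP[yX yiX].
  have [yx | yx] := eqVneq y x.
    by rewrite -yx imset_f ?orbT // inE -yx.
  have [yix | yix] := eqVneq (y * gen i) x; last by rewrite yX yiX.
  apply/orP; right; apply/orP; right; apply/imsetP; exists i.
    by rewrite inE -yix mul_genK.
  by rewrite -yix mul_genK.
apply: leq_trans (subset_leq_card sub) _.
apply: leq_trans (leq_card_setU _ _) _.
rewrite mulnS addnC leq_add // (leq_trans (leq_card_setU _ _)) //.
by rewrite (@leq_add _ _ 1 1) // (leq_trans (leq_imset_card _ _)).
Qed.

Lemma card_out_darts_small X : #|X| <= m -> #|X| <= #|out_darts X|.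
Proof.
move=> /card_inner_darts_small; have := card_darts X; lia.
Qed.

(* Among the sets minimising the edge boundary take a smallest one. By
   submodularity its translates are pairwise equal or disjoint, so all its
   vertices have the same number of neighbours outside of it. *)
Lemma card_out_darts_ge k X : 0 < k -> (2 * k)%N <= m ->
  k <= #|X| -> #|X| + k <= #|gT| -> k <= #|out_darts X|.
Proof.
move=> k0 km kX Xk.
(* Both the set and its complement have at least [k] elements, a condition stable under
   complement. *)
pose P Y := (k <= #|Y|) && (#|Y| + k <= #|gT|).
have PX : P X by rewrite /P kX Xk.
case: (arg_minnP (fun Y => #|out_darts Y|) PX) => B PB Bmin0.
have Bmin Y : P Y -> #|out_darts B| <= #|out_darts Y| := Bmin0 Y.
rewrite leqNgt; apply/negP=> /(leq_ltn_trans (Bmin X PX)) Bk.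
pose Q Y := P Y && (#|out_darts Y| <= #|out_darts B|).
have QB : Q B by rewrite /Q PB leqnn.
case: (arg_minnP (fun Y => #|Y|) QB) => A /andP[PA AB] Amin0.
have Amin Y : Q Y -> #|A| <= #|Y| := Amin0 Y.
have cC Y : #|Y| + #|~: Y| = #|gT| := cardsC Y.
have PC Y : P Y -> P (~: Y).
  by rewrite /P => /andP[PY1 PY2]; have := cC Y; lia.
have A_half : (2 * #|A|)%N <= #|gT|.
  have : #|A| <= #|~: A| by apply: Amin; rewrite /Q PC ?card_out_darts_setC.
  by have := cC A; lia.
have Am : m < #|A|.
  rewrite ltnNge; apply/negP=> /card_out_darts_small.
  by have /andP[] := PA; lia.
(* The union has boundary at least the minimum, so by submodularity the intersection attains it too
   and cannot be smaller than [A]. *)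
have uncross Y Z : P (Y :&: Z) -> P (Y :|: Z) ->
    #|out_darts Y| <= #|out_darts B| -> #|out_darts Z| <= #|out_darts B| ->
    #|A| <= #|Y :&: Z|.
  move=> PI PU YB ZB; apply: Amin; apply/andP; split=> //.
  by have := card_out_darts_submodular Y Z; have := Bmin _ PU; lia.
have /andP[kA Ak] := PA.
have translate_eq h (A' : {set gT}) : A' = h *: A -> A :&: A' != set0 -> A' = A.
  move=> A'E AA'.
  have cA' : #|A'| = #|A| by rewrite A'E card_lcoset.
  have A'B : #|out_darts A'| <= #|out_darts B|.
    by rewrite A'E card_out_darts_lcoset.
  have cU : #|A :|: A'| + #|A :&: A'| = #|A| + #|A| by rewrite cardsUI cA'.
  have cI : #|A :&: A'| + #|A :\: A'| = #|A| := cardsID A' A.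
  have cI' : #|A :&: A'| + #|A' :\: A| = #|A| by rewrite setIC cardsID.
  suff AI : #|A| <= #|A :&: A'|.
    have IA : A :&: A' = A by apply/eqP; rewrite eqEcard subsetIl.
    by apply/esym/eqP; rewrite eqEcard cA' leqnn andbT -IA subsetIr.
  (* For a large intersection uncross [A] with [A']. For a small one uncross [A] with the complement
     of [A']: both differences still have at least [k] elements because [#|A|] exceeds [m >= 2k],
     and the outcome contradicts the intersection being nonempty. *)
  have [kI | Ik] := leqP k #|A :&: A'|.
    by apply: uncross => //; rewrite /P; lia.
  have : #|A| <= #|A :&: ~: A'|.
    have PD : P (A :\: A') by rewrite /P; lia.
    have PD' : P (A' :\: A) by rewrite /P; lia.
    apply: uncross => //; rewrite ?card_out_darts_setC // -?setDE //.
    by rewrite -[A :|: _]setCK setCU setCK setIC -setDE; apply: PC.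
  have I0 : 0 < #|A :&: A'| by rewrite card_gt0.
  by rewrite -setDE; lia.
have [x xA] : exists x, x \in A by apply/card_gt0P; lia.
(* If the [i]-edge at [y] leaves [A], then so does the [i]-edge at any [z] in [A], since the
   translation taking [y] to [z] preserves [A]. The boundary would then have at least [#|A| >= k]
   edges. *)
have closedA y i : y \in A -> y * gen i \in A.
  move=> yA; apply/negPn/negP=> yiA.
  have out z : z \in A -> z * gen i \notin A.
    move=> zA; apply: contra yiA.
    rewrite -{1}(translate_eq (z * y^-1) _ (erefl _)).
      by rewrite mem_lcoset invMg invgK !mulgA mulgKV.
    by apply/set0Pn; exists z; rewrite inE zA mem_lcoset invMg invgK mulgKV.
  have : #|A| <= #|out_darts A|.
    rewrite -(card_imset A (_ : injective (pair^~ i))) => [|? ? []] //.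
    by apply/subset_leq_card/subsetP=> _ /imsetP[z zA ->]; rewrite inE /= zA out.
  lia.
have AT : #|A| = #|gT| by rewrite (gen_closed_setT xA closedA) cardsT.
lia.
Qed.

(** * Cycles as words in the generators, girth and cyclic connectivity *)

Lemma path_scanl x p : path cayley_adj x p ->
  exists w, p = scanl (fun y i => y * gen i) x w.
Proof.
elim: p x => [|y p IHp] x /=; first by exists [::].
by case/andP=> /cayley_adjP[i ->] /IHp[w ->]; exists (i :: w).
Qed.

Lemma last_scanl x w :
  last x (scanl (fun y i => y * gen i) x w) = x * word_prod w.
Proof.
elim: w x => [|i w IHw] x /=; first by rewrite /word_prod big_nil mulg1.
by rewrite IHw word_prod_cons mulgA.
Qed.

(** A repeated letter returns to the vertex two steps earlier. As [p] omits the start [x], a return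
    to [x] at the second step needs its own hypothesis; the default value of [nth] differs from [x],
    so that short walks satisfy it. *)
Lemma uniq_scanl_reduced x w : let p := scanl (fun y i => y * gen i) x w in
  uniq p -> nth (x * gen ord0) p 1 != x -> reduced w.
Proof.
elim: w x => [|i [|j w] IHw] x //= /andP[xi uw] xij; apply/andP; split.
  by apply: contra xij => /eqP->; rewrite mul_genK.
apply: (IHw (x * gen i)) => //=.
case: w {IHw uw} xi => [|l w] /=.
  by rewrite mul_gen_neq.
by rewrite !inE !negb_or => /and3P[_ + _]; rewrite eq_sym.
Qed.

(** The labels along a cycle form a reduced word with product 1. *)
Lemma cayley_cycle_size c : is_cycle cayley_adj c -> m < size c.
Proof.
case/and3P; case: c => [|x [|y [|z s]]] // _ cU /path_scanl[w wE].
rewrite ltnNge; apply/negP=> cm.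
have size_w : size w = size (x :: y :: z :: s).
  by rewrite -(size_scanl (fun y i => y * gen i) x) -wE /= size_rcons.
have /negP[] : word_prod w != 1.
  apply: word_prod_neq1; first by rewrite size_w cm.
  apply: (@uniq_scanl_reduced x); rewrite -wE.
    by rewrite rcons_uniq.
  by move: cU; rewrite /= !inE !negb_or (eq_sym z) => /andP[/and3P[]].
apply/eqP/(mulgI x); rewrite mulg1 -last_scanl -wE /= last_rcons //.
Qed.

Lemma delete_edges_sym F : symmetric (delete_edges cayley_adj F).
Proof. by move=> x y; rewrite /delete_edges /= cayley_sym setUC. Qed.

Lemma card_has_cycle_in F X :
  has_cycle_in (delete_edges cayley_adj F) X -> m < #|X|.
Proof.
case=> c /and3P[c3 cU cc] cX.
have /cayley_cycle_size/leq_trans : is_cycle cayley_adj c.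
  by rewrite /is_cycle c3 cU; apply: sub_cycle cc => x y /andP[].
apply; rewrite -(card_uniqP cU); exact/subset_leq_card/subsetP.
Qed.

(** An edge leaving the component must have been deleted. The edge determines the dart: only one of
    its ends is in the component, and the generators are distinct. *)
Lemma card_out_darts_component F x :
  #|out_darts (component (delete_edges cayley_adj F) x)| <= #|F|.
Proof.
set e := delete_edges _ _; set X := component e x.
pose f (d : gT * 'I_3) := [set d.1; d.1 * gen d.2].
have f_inj : {in out_darts X &, injective f}.
  move=> [y i] [z j]; rewrite !in_set /= => /andP[yX yiX] /andP[zX zjX] fE.
  have yz : y = z.
    have : y \in f (z, j) by rewrite -fE !inE eqxx.
    by rewrite !inE /= => /orP[]/eqP // yE; rewrite -yE yX in zjX.
  have : y * gen i \in f (z, j) by rewrite -fE !inE eqxx orbT.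
  rewrite !inE /= => /orP[]/eqP yiE; first by rewrite yiE zX in yiX.
  by congr (_, _) => //; apply/gen_inj/(mulgI y); rewrite yiE yz.
rewrite -(card_in_imset f_inj); apply/subset_leq_card/subsetP.
move=> _ /imsetP[[y i] + ->].
rewrite inE /= => /andP[yX yiX]; apply: contraNT yiX => yF.
rewrite !inE in yX *; apply: connect_trans yX (connect1 _).
by rewrite /e /delete_edges /= cayley_adj_gen.
Qed.

(** Two components with a cycle have more than [m >= 2k] vertices each, so the boundary bound
    applies to one of them and yields at least [k] deleted edges. *)
Lemma cayley_cyclically_edge_connected k : 0 < k -> (2 * k)%N <= m ->
  two_disjoint_cycles cayley_adj -> cyclically_edge_connected k cayley_adj.
Proof.
move=> k0 km cycles; split=> // [|F _ Fk]; first exact: cayley_connected.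
move=> [x [y [XY /card_has_cycle_in Xm /card_has_cycle_in Ym]]].
set X := component _ x in XY Xm; set Y := component _ y in XY Ym.
have symF := sym_connect_sym (delete_edges_sym F).
have disj : [disjoint X & Y].
  apply/pred0P=> z /=; apply/negbTE/negP; rewrite !inE => /andP[xz yz].
  case: XY; apply/setP=> u; rewrite !inE.
  by rewrite (same_connect symF xz) (same_connect symF yz).
have XYg : #|X| + #|Y| <= #|gT|.
  by have [_] := leq_card_setU X Y; rewrite disj => /eqP <-; apply: max_card.
have : k <= #|out_darts X| by apply: card_out_darts_ge; lia.
have := card_out_darts_component F x; rewrite -/X; lia.
Qed.

(** * Consequences of the two signs: disjoint cycles and absence of a Hist *)

Variables p q : pred gT.
Hypothesis p_gen : forall x i, p (x * gen i) = ~~ p x.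
Hypothesis q_gen : forall x i, q (x * gen i) = q x (+) (i == ord_max).

(* Following the generators 0 and 1 alternately never changes [q]. *)
Lemma cayley_two_disjoint_cycles : two_disjoint_cycles cayley_adj.
Proof.
pose one : 'I_3 := inord 1.
have one0 : one != ord0 by rewrite -val_eqE /= inordK.
have oneM : one != ord_max by rewrite -val_eqE /= inordK.
(* Every step flips [p], so choosing the generator by [p] makes the two generators alternate and
   keeps [alt] injective. *)
pose alt x := x * gen (if p x then one else ord0).
have p_alt x : p (alt x) = ~~ p x by rewrite p_gen.
have q_alt x : q (alt x) = q x.
  by rewrite q_gen; case: (p x); rewrite ?(negPf oneM) addbF.
have alt_inj : injective alt.
  move=> x y xy; have : p (alt x) = p (alt y) by rewrite xy.
  rewrite !p_alt => /negb_inj pxy.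
  by move: xy; rewrite /alt pxy => /mulIg.
have alt_cycle x : is_cycle cayley_adj (fingraph.orbit alt x).
  apply/and3P; split; last 1 first.
  - by apply: sub_cycle (cycle_orbit alt_inj x) => y z /eqP <-;
    apply: cayley_adj_gen.
  - rewrite fingraph.size_orbit; have := iter_order alt_inj x.
    have := fingraph.order_gt0 alt x.
    case: (fingraph.order alt x) => [|[|[|n]]] // _ /=.
      by move/(congr1 p); rewrite p_alt; case: (p x).
    (* In an orbit of length two the steps out and back would use the same edge, forcing the
       generators 0 and 1 to coincide. *)
    move=> e; have : alt (alt x) * gen (if p (alt x) then one else ord0) = alt x.
      exact: mul_genK.
    rewrite e p_alt => /(mulgI x)/gen_inj.
    by case: (p x) => /eqP; rewrite ?(negPf one0) // eq_sym (negPf one0).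
  - exact: fingraph.orbit_uniq.
have q_orbit x y : y \in fingraph.orbit alt x -> q y = q x.
  by case/trajectP=> n _ ->; elim: n => //= n <-.
exists (fingraph.orbit alt 1), (fingraph.orbit alt (1 * gen ord_max)).
split=> //.
apply/pred0P=> x /=; apply/negbTE/negP=> /andP[/q_orbit qx /q_orbit].
by rewrite q_gen qx eqxx; case: (q 1).
Qed.

Lemma cayley_no_hist : ~ has_hist cayley_adj.
Proof.
have card_half (r s : {pred gT}) (f : gT -> gT) : injective f ->
    {homo f : x / x \in r >-> x \in s} -> #|r| <= #|s|.
  move=> f_inj rs; rewrite -(card_image f_inj); apply/subset_leq_card/subsetP.
  by move=> _ /imageP[x xr ->]; apply: rs.
have inj_gen i : injective (mulg^~ (gen i)) by move=> x y /mulIg.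
apply: (@bipartite_no_hist _ _ p).
- exact: cayley_irrefl.
- exact: cayley_cubic.
- by move=> x y /cayley_adjP[i ->].
- rewrite -(cardC p) (_ : #|[predC p]| = #|p|) ?addnn ?odd_double //.
  apply/anti_leq/andP; split; apply: (card_half _ _ _ (inj_gen ord0)) => x;
    by rewrite !unfold_in /= p_gen // negbK.
(* Two steps, by generator 0 and then by the last one, preserve [p] and flip [q], so they match the
   two halves of the class [p]. *)
rewrite -(cardID q p) (_ : #|[predI p & q]| = #|[predD p & q]|).
  by rewrite addnn odd_double.
have inj_gen2 := inj_comp (inj_gen ord_max) (inj_gen ord0).
apply/anti_leq/andP; split; apply: (card_half _ _ _ inj_gen2) => x;
  rewrite !unfold_in /= !p_gen !q_gen negbK;
  by case: (p x); case: (q x).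
Qed.

End InvolutionCayleyGraph.

(** * A finite group with no short relations, acting on truncated reduced words *)

(** Left multiplication by a generator in the free product of three groups of order 2, on normal
    forms. *)
Definition mul_letter (i : 'I_3) (w : seq 'I_3) : seq 'I_3 :=
  if w is j :: w' then if j == i then w' else i :: w else [:: i].

Lemma reduced_mul_letter i w : reduced w -> reduced (mul_letter i w).
Proof.
case: w => //= j w; have [-> | ji] := eqVneq j i; first exact: path_sorted.
by rewrite /reduced /= eq_sym ji.
Qed.

Lemma mul_letterK i w : reduced w -> mul_letter i (mul_letter i w) = w.
Proof.
case: w => [|j w] /=; first by rewrite eqxx.
have [-> | ji _] := eqVneq j i; last by rewrite /= eqxx.
by case: w => //= l w /andP[il _]; rewrite eq_sym (negPf il).
Qed.

Section TruncatedWordAction.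
Variable m : nat.
Local Open Scope group_scope.
Local Notation W := (m.-bseq 'I_3).

(** Fixing the words that are not reduced or would become too long keeps the map an involution of a
    finite set. *)
Definition letter_act (i : 'I_3) (b : W) : W :=
  if reduced b && (size (mul_letter i b) <= m)
  then insub_bseq m (mul_letter i b) else b.

Lemma letter_actE i (b : W) : reduced b -> size (mul_letter i b) <= m ->
  letter_act i b = mul_letter i b :> seq 'I_3.
Proof. by move=> bred bm; rewrite /letter_act bred bm /= val_insubd bm. Qed.

Lemma letter_actK i : involutive (letter_act i).
Proof.
move=> b; case E: (reduced b && (size (mul_letter i b) <= m)); last first.
  by rewrite /letter_act E E.
have [bred bm] := andP E; have bE := letter_actE bred bm.
apply: val_inj; rewrite /= letter_actE bE ?mul_letterK //.
  exact: reduced_mul_letter.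
exact: size_bseq.
Qed.

Definition letter_perm i : {perm W} := perm (inv_inj (letter_actK i)).

Lemma letter_perm_invol i : letter_perm i * letter_perm i = 1.
Proof. by apply/permP=> b; rewrite permM !permE letter_actK. Qed.

(** Permutations compose from left to right, so the letters of [w] are put in front of [b] one after
    another and end up reversed. The hypotheses rule out cancellation and truncation on the way. *)
Lemma prod_letter_permE (w : seq 'I_3) (b : W) :
  reduced (catrev w b) -> size (catrev w b) <= m ->
  (\prod_(i <- w) letter_perm i) b = catrev w b :> seq 'I_3.
Proof.
elim: w b => [|i w IHw] b /=; first by rewrite big_nil perm1.
move=> red szm; rewrite big_cons permM permE.
have ib : reduced (i :: b) by move: red; rewrite catrevE => /cat_sorted2[].
have mulE : mul_letter i b = i :: b.
  by move: ib; case: (bseqval b) => //= j w' /andP[ij _];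
    rewrite eq_sym (negPf ij).
have actE : letter_act i b = i :: b :> seq 'I_3.
  rewrite letter_actE ?mulE //; first exact: path_sorted ib.
  by apply: leq_trans szm; rewrite catrevE size_cat leq_addl.
by rewrite IHw actE.
Qed.

(** [{perm bool}] serves as the group of order 2, its nontrivial element being recognised by
    [odd_perm]. *)
Definition flip : {perm bool} := tperm true false.

Lemma flip_invol : flip * flip = 1.
Proof. exact: tperm2. Qed.

Definition letter_gen (i : 'I_3) : {perm W} * {perm bool} * {perm bool} :=
  (letter_perm i, flip, if i == ord_max then flip else 1).

Definition letter_group :=
  <<[set letter_gen i | i : 'I_3]>>%G.

(** Taking the generated subgroup as a type of its own makes the three elements generate all
    vertices, which gives connectivity. *)
Definition vertex_gen i : subg_of letter_group :=
  subg letter_group (letter_gen i).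

Lemma val_vertex_gen i : val (vertex_gen i) = letter_gen i.
Proof. by rewrite subgK // mem_gen // imset_f. Qed.

Lemma vertex_gen_invol i : vertex_gen i * vertex_gen i = 1.
Proof.
apply: val_inj; rewrite /= !val_vertex_gen; congr (_, _, _).
- exact: letter_perm_invol.
- exact: flip_invol.
by rewrite /letter_gen /=; case: (i == _); [exact: flip_invol | exact: mulg1].
Qed.

Lemma val_word_prod w :
  val (word_prod vertex_gen w) = word_prod letter_gen w.
Proof.
elim: w => [|i w IHw]; first by rewrite /word_prod !big_nil.
by rewrite !word_prod_cons /= IHw val_vertex_gen.
Qed.

Lemma vertex_gen_words x : exists w, x = word_prod vertex_gen w.
Proof.
have /gen_prodgP[n [c cS xE]] := valP x.
suff [w wE] : exists w, \prod_i c i = word_prod letter_gen w.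
  by exists w; apply: val_inj; rewrite val_word_prod -wE -xE.
elim: n c cS {xE} => [|n IHn] c cS.
  by exists [::]; rewrite /word_prod big_ord0 big_nil.
have [w wE] := IHn _ (fun i => cS (lift ord0 i)).
have /imsetP[i _ cE] := cS ord0.
by exists (i :: w); rewrite big_ord_recl wE cE word_prod_cons.
Qed.

Lemma word_prod_letter_gen w :
  (word_prod letter_gen w).1.1 = \prod_(i <- w) letter_perm i.
Proof.
elim: w => [|i w IHw]; first by rewrite /word_prod !big_nil.
by rewrite word_prod_cons big_cons -IHw.
Qed.

Lemma word_prod_vertex_gen_neq1 w :
  0 < size w <= m -> reduced w -> word_prod vertex_gen w != 1.
Proof.
move=> /andP[w0 wm] redw; apply/eqP=> /(congr1 val).
rewrite val_word_prod => /(congr1 (fun x => x.1.1)).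
(* Evaluate at the empty word: the product sends it to [rev w], which is nonempty. *)
rewrite word_prod_letter_gen => /permP/(_ [bseq])/(congr1 val).
rewrite /= prod_letter_permE ?perm1 /= -/(rev w) ?size_rev //.
  by move/(congr1 size); rewrite size_rev /=; case: (size w) w0.
rewrite /reduced rev_sorted; apply: sub_sorted redw => i j /=.
by rewrite eq_sym.
Qed.

End TruncatedWordAction.

(** * Assembling the graph for [m = 2k], with the signs of the two [{perm bool}] components as [p]
    and [q] *)

Theorem mainTheorem3 (k : nat) (hk : 0 < k) :
  exists G : sgraph,
    [/\ cubic (@adj G), cyclically_edge_connected k (@adj G)
      & ~ has_hist (@adj G)].
Proof.
pose m := 2 * k.
have m1 : 1 < m by rewrite /m; lia.
have invol := @vertex_gen_invol m.
have words := @vertex_gen_words m.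
have neq1 := @word_prod_vertex_gen_neq1 m.
pose p := [pred x : subg_of (letter_group m) | odd_perm (val x).1.2].
pose q := [pred x : subg_of (letter_group m) | odd_perm (val x).2].
have p_gen x i : p (x * vertex_gen m i)%g = ~~ p x.
  by rewrite /= val_vertex_gen odd_permM odd_tperm addbT.
have q_gen x i : q (x * vertex_gen m i)%g = q x (+) (i == ord_max).
  rewrite /= val_vertex_gen odd_permM /=; case: (i == _).
    by rewrite odd_tperm.
  by rewrite odd_perm1.
exists (SGraph (cayley_sym invol) (cayley_irrefl neq1 m1)); split.
- exact: cayley_cubic neq1 m1.
- apply: (cayley_cyclically_edge_connected invol words neq1 m1 hk) => //.
  exact: (cayley_two_disjoint_cycles invol neq1 m1 p_gen q_gen).
- exact: (cayley_no_hist invol neq1 m1 p_gen q_gen).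
Qed.
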